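(* Let $\mathfrak{g}=\mathfrak{sl}_2\otimes\mathfrak{J}\oplus V\otimes\mathfrak{M}\oplus\mathfrak{D}$ be a short $\mathfrak{sl}_2$-Lie superalgebra, with operations $\cdot,\bullet,\star,\partial$ determined by its bracket. Then $(\mathfrak{J},\mathfrak{M})$, with the operations $\cdot,\bullet,\star$, is a $\mathfrak{J}$-ternary superalgebra with the triple product $(-,-,-):\mathfrak{M}\otimes\mathfrak{M}\otimes\mathfrak{M}\to\mathfrak{M}$ given by $$(m,n,s):=-\partial_{m,n}(s)+\tfrac12(m\star n)\bullet s .$$
   Context: Everything is over $\mathbb{C}$; superspaces are $\mathbb{Z}_2$-graded. $\mathfrak{sl}_2=\mathfrak{sl}_2(\mathbb{C})$ has standard basis $e,f,h$; $V=\mathbb{C}e_1\oplus\mathbb{C}e_2$ is its natural representation; both have even degree. $\kappa(x,y)=4\,\mathrm{tr}(xy)$; $\det:V\otimes V\to\mathbb{C}$ is the determinant form; $\odot:V\otimes V\to\mathfrak{sl}_2$ is bilinear with $e_1\odot e_1=e$, $e_1\odot e_2=e_2\odot e_1=-\tfrac12h$, $e_2\odot e_2=-f$. A short $\mathfrak{sl}_2$-Lie superalgebra is a Lie superalgebra $\mathfrak{g}$ on which $\mathfrak{sl}_2$ acts by even derivations, with an $\mathfrak{sl}_2$-module decomposition $\mathfrak{g}=\mathfrak{sl}_2\otimes\mathfrak{J}\oplus V\otimes\mathfrak{M}\oplus\mathfrak{D}$, where $\mathfrak{J},\mathfrak{M},\mathfrak{D}$ are superspaces with trivial $\mathfrak{sl}_2$-action,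 so $\mathfrak{D}=\mathfrak{g}^{\mathfrak{sl}_2}$. By $\mathfrak{sl}_2$-invariance its bracket has the form $[d,x\otimes a]=x\otimes d(a)$, $[d,v\otimes m]=v\otimes d(m)$, $[x\otimes a,y\otimes b]=[x,y]\otimes a\cdot b+\tfrac12\kappa(x,y)\langle a,b\rangle$, $[x\otimes a,v\otimes m]=x(v)\otimes a\bullet m$, $[v\otimes m,w\otimes n]=(v\odot w)\otimes m\star n+\det(v,w)\partial_{m,n}$ (for $x,y\in\mathfrak{sl}_2$, $v,w\in V$, $a,b\in\mathfrak{J}$, $m,n\in\mathfrak{M}$, $d\in\mathfrak{D}$) for unique even bilinear maps $\cdot:\mathfrak{J}\otimes\mathfrak{J}\to\mathfrak{J}$, $\bullet:\mathfrak{J}\otimes\mathfrak{M}\to\mathfrak{M}$, $\star:\mathfrak{M}\otimes\mathfrak{M}\to\mathfrak{J}$, $\langle-,-\rangle:\mathfrak{J}\otimes\mathfrak{J}\to\mathfrak{D}$, $\partial:\mathfrak{M}\otimes\mathfrak{M}\to\mathfrak{D}$ (and even actions of $\mathfrak{D}$ on $\mathfrak{J}$ and $\mathfrak{M}$). A Jordan superalgebra is a superspace $\mathfrak{J}$ with an even product satisfying $a\cdot b=(-1)^{|a||b|}b\cdot a$ and $(a\cdot b)\cdot(c\cdot d)+(-1)^{|b||c|}(a\cdot c)\cdot(b\cdot d)+(-1)^{|b||d|+|c||d|}(a\cdot d)\cdot(b\cdot c)=((a\cdot b)\cdot c)\cdot d+(-1)^{|b||c|+|b||d|+|c||d|}((a\cdot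 d)\cdot c)\cdot b+(-1)^{|a||b|+|a||c|+|a||d|+|c||d|}((b\cdot d)\cdot c)\cdot a$. A special $\mathfrak{J}$-supermodule is a superspace $\mathfrak{M}$ with an even bilinear $\bullet:\mathfrak{J}\otimes\mathfrak{M}\to\mathfrak{M}$ such that $(a\cdot b)\bullet m=\tfrac12(a\bullet(b\bullet m)+(-1)^{|a||b|}b\bullet(a\bullet m))$. A $\mathfrak{J}$-ternary superalgebra $(\mathfrak{J},\mathfrak{M})$ consists of a Jordan superalgebra $(\mathfrak{J},\cdot)$, a special $\mathfrak{J}$-supermodule $(\mathfrak{M},\bullet)$, an even super-anticommutative bilinear map $\star:\mathfrak{M}\otimes\mathfrak{M}\to\mathfrak{J}$ ($m\star n=-(-1)^{|m||n|}n\star m$) and an even trilinear product $(-,-,-):\mathfrak{M}^{\otimes3}\to\mathfrak{M}$ such that for all homogeneous $a\in\mathfrak{J}$, $m,n,r,s,t\in\mathfrak{M}$: (SJT1) $a\cdot(m\star n)=\tfrac12((a\bullet m)\star n+(-1)^{|a||m|}m\star(a\bullet n))$; (SJT2) $a\bullet(m,n,s)=(a\bullet m,n,s)-(-1)^{|a||m|}(m,a\bullet n,s)+(-1)^{|a|(|m|+|n|)}(m,n,a\bullet s)$; (SJT3) $(m,n,s)=(-1)^{|m|(|n|+|s|)+|n||s|}(s,n,m)-(-1)^{|n||s|}(m\star s)\bullet n$; (SJT4) $(m,n,s)=(-1)^{|m||n|}(n,m,s)+(m\star n)\bullet s$; (SJT5) $(m,n,r)\star s+(-1)^{|r|(|m|+|n|)}r\star(m,n,s)=(-1)^{|n|(|r|+|s|)}m\star((r\star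 s)\bullet n)$; (SJT6) $(m,n,(r,s,t))=((m,n,r),s,t)+(-1)^{|r|(|m|+|n|)+|m||n|}(r,(n,m,s),t)+(-1)^{(|m|+|n|)(|r|+|s|)}(r,s,(m,n,t))$. *)

(* Defs.v *)
From HB Require Import structures.
From mathcomp Require Import all_boot all_order all_algebra.

Set Implicit Arguments.
Unset Strict Implicit.
Unset Printing Implicit Defensive.

Import GRing.Theory.
Local Open Scope ring_scope.

(* Throughout, parities are booleans (true = odd); in an exponent they are read
   in nat, so [(-1) ^+ (p * q + r)] is the usual Koszul sign. *)

(** * The Lie algebra sl_2 and its natural representation 'cV_2 *)

Definition traceless (K : fieldType) : {pred 'M[K]_2} := fun A => \tr A == 0.

Lemma traceless_submod_closed (K : fieldType) : submod_closed (@traceless K).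
Proof.
split=> [|c A B /eqP trA /eqP trB]; first by apply/eqP; exact: raddf0.
by apply/eqP; rewrite mxtraceD mxtraceZ trA trB mulr0 addr0.
Qed.

HB.instance Definition _ (K : fieldType) :=
  GRing.isSubmodClosed.Build K 'M[K]_2 (@traceless K)
    (@traceless_submod_closed K).

Record sl2 (K : fieldType) := Sl2 {
  sl2_val :> 'M[K]_2;
  sl2_valP : sl2_val \in @traceless K
}.

HB.instance Definition _ (K : fieldType) := [isSub for @sl2_val K].
HB.instance Definition _ (K : fieldType) := [Choice of sl2 K by <:].
HB.instance Definition _ (K : fieldType) :=
  [SubChoice_isSubLmodule of sl2 K by <:].

Lemma sl2_e_subproof (K : fieldType) : delta_mx 0 1 \in @traceless K.
Proof. by apply/eqP; rewrite /mxtrace !big_ord_recl big_ord0 !mxE /= !addr0. Qed.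

Lemma sl2_f_subproof (K : fieldType) : delta_mx 1 0 \in @traceless K.
Proof. by apply/eqP; rewrite /mxtrace !big_ord_recl big_ord0 !mxE /= !addr0. Qed.

Lemma sl2_h_subproof (K : fieldType) :
  delta_mx 0 0 - delta_mx 1 1 \in @traceless K.
Proof.
apply/eqP; rewrite /mxtrace !big_ord_recl big_ord0 !mxE /=.
by rewrite subr0 sub0r addr0 subrr.
Qed.

Definition sl2_e (K : fieldType) : sl2 K := Sl2 (sl2_e_subproof K).
Definition sl2_f (K : fieldType) : sl2 K := Sl2 (sl2_f_subproof K).
Definition sl2_h (K : fieldType) : sl2 K := Sl2 (sl2_h_subproof K).

Lemma sl2_br_subproof (K : fieldType) (x y : sl2 K) :
  sl2_val x *m sl2_val y - sl2_val y *m sl2_val x \in @traceless K.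
Proof. by apply/eqP; rewrite raddfB /= mxtrace_mulC subrr. Qed.

Definition sl2_br (K : fieldType) (x y : sl2 K) : sl2 K :=
  Sl2 (sl2_br_subproof x y).

(* The Killing form of sl_2. *)
Definition kappa (K : fieldType) (x y : sl2 K) : K :=
  4%:R * \tr (sl2_val x *m sl2_val y).

Definition det_form (K : fieldType) (v w : 'cV[K]_2) : K := \det (row_mx v w).

(* The bilinear map with e1 (.) e1 = e, e1 (.) e2 = e2 (.) e1 = - h / 2 and
   e2 (.) e2 = - f, written in the coordinates of v and w. *)
Definition odotV (K : fieldType) (v w : 'cV[K]_2) : sl2 K :=
  (v 0 0 * w 0 0) *: sl2_e K
  - (2%:R^-1 * (v 0 0 * w 1 0 + v 1 0 * w 0 0)) *: sl2_h K
  - (v 1 0 * w 1 0) *: sl2_f K.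

(** * Superspaces and even maps *)

Record superspace (K : fieldType) := Superspace {
  super_sort :> lmodType K;
  homog : bool -> super_sort -> Prop;
  homog0 : forall p, homog p 0;
  homogP : forall p (c : K) x y,
    homog p x -> homog p y -> homog p (c *: x + y);
  homog_decomp : forall x, exists x0 x1,
    [/\ homog false x0, homog true x1 & x = x0 + x1];
  homog_disjoint : forall x, homog false x -> homog true x -> x = 0
}.
Arguments homog {K s} p x.

Definition even_map2 (K : fieldType) (U V W : superspace K)
    (f : U -> V -> W) : Prop :=
  forall p q u v, homog p u -> homog q v -> homog (p (+) q) (f u v).

Definition even_map3 (K : fieldType) (U V W X : superspace K)
    (f : U -> V -> W -> X) : Prop :=
  forall p q r u v w, homog p u -> homog q v -> homog r w ->
    homog (p (+) q (+) r) (f u v w).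

Definition trilinear (K : fieldType) (U V W X : lmodType K)
    (f : U -> V -> W -> X) : Prop :=
  [/\ forall v w, linear (fun u => f u v w),
      forall u w, linear (fun v => f u v w)
    & forall u v, linear (f u v)].

(* Universal property: every bilinear map out of U x W factors uniquely
   through t. *)
Definition is_tensor_product (K : fieldType) (U W T : lmodType K)
    (t : {bilinear U -> W -> T}) : Prop :=
  forall (X : lmodType K) (b : {bilinear U -> W -> X}),
  exists2 F : {linear T -> X}, (forall u w, F (t u w) = b u w)
    & forall G : {linear T -> X}, (forall u w, G (t u w) = b u w) -> G =1 F.

(** * Lie superalgebras and short sl_2-Lie superalgebras *)

Record lieSuperalgebra (K : fieldType) := LieSuperalgebra {
  lie_sort :> superspace K;
  lie_br : {bilinear lie_sort -> lie_sort -> lie_sort};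
  lie_br_even : even_map2 lie_br;
  lie_br_skew : forall p q x y, homog p x -> homog q y ->
    lie_br x y = - ((-1) ^+ (p * q) *: lie_br y x);
  lie_br_jacobi : forall p q x y z, homog p x -> homog q y ->
    lie_br x (lie_br y z) =
      lie_br (lie_br x y) z + (-1) ^+ (p * q) *: lie_br y (lie_br x z)
}.

(* sl_2 (x) J and V (x) M are given by arbitrary tensor products [short_tJ] and
   [short_tM], and the decomposition of the Lie superalgebra by a linear
   isomorphism from sl_2 (x) J + V (x) M + D, compatible with parities and with
   the action of sl_2. *)
Record shortSl2 (K : fieldType) (J M D : superspace K) := ShortSl2 {
  short_lie :> lieSuperalgebra K;

  short_act : {bilinear sl2 K -> short_lie -> short_lie};
  short_act_br : forall x y z,
    short_act (sl2_br x y) z =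
      short_act x (short_act y z) - short_act y (short_act x z);
  short_act_even : forall x p z, homog p z -> homog p (short_act x z);
  short_act_der : forall x z w,
    short_act x (lie_br _ z w) =
      lie_br _ (short_act x z) w + lie_br _ z (short_act x w);

  short_sl2J : lmodType K;
  short_tJ : {bilinear sl2 K -> J -> short_sl2J};
  short_tJP : is_tensor_product short_tJ;
  short_VM : lmodType K;
  short_tM : {bilinear 'cV[K]_2 -> M -> short_VM};
  short_tMP : is_tensor_product short_tM;

  short_dec : {linear (short_sl2J * short_VM * D)%type -> short_lie};
  short_dec_bij : bijective short_dec;
  short_dec_homogJ : forall p x a,
    homog p a -> homog p (short_dec (short_tJ x a, 0, 0));
  short_dec_homogM : forall p v m,
    homog p m -> homog p (short_dec (0, short_tM v m, 0));
  short_dec_homogD : forall p d, homog p d -> homog p (short_dec (0, 0, d));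
  short_dec_actJ : forall x y a,
    short_act x (short_dec (short_tJ y a, 0, 0)) =
      short_dec (short_tJ (sl2_br x y) a, 0, 0);
  short_dec_actM : forall x v m,
    short_act x (short_dec (0, short_tM v m, 0)) =
      short_dec (0, short_tM (sl2_val x *m v) m, 0);
  short_dec_actD : forall x d, short_act x (short_dec (0, 0, d)) = 0
}.

Section Embeddings.
Variables (K : fieldType) (J M D : superspace K) (g : shortSl2 J M D).

Definition inJ (x : sl2 K) (a : J) : g := short_dec g (short_tJ g x a, 0, 0).
Definition inM (v : 'cV[K]_2) (m : M) : g := short_dec g (0, short_tM g v m, 0).
Definition inD (d : D) : g := short_dec g (0, 0, d).

End Embeddings.

(* The operations determined by the bracket of g. *)
Record shortOps (K : fieldType) (J M D : superspace K) (g : shortSl2 J M D) :=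
  ShortOps {
  op_dJ : {bilinear D -> J -> J};
  op_dM : {bilinear D -> M -> M};
  op_dot : {bilinear J -> J -> J};
  op_bullet : {bilinear J -> M -> M};
  op_star : {bilinear M -> M -> J};
  op_angle : {bilinear J -> J -> D};
  op_partial : {bilinear M -> M -> D};

  op_dJ_even : even_map2 op_dJ;
  op_dM_even : even_map2 op_dM;
  op_dot_even : even_map2 op_dot;
  op_bullet_even : even_map2 op_bullet;
  op_star_even : even_map2 op_star;
  op_angle_even : even_map2 op_angle;
  op_partial_even : even_map2 op_partial;

  op_brDJ : forall d x a,
    lie_br g (inD g d) (inJ g x a) = inJ g x (op_dJ d a);
  op_brDM : forall d v m,
    lie_br g (inD g d) (inM g v m) = inM g v (op_dM d m);
  op_brJJ : forall x y a b,
    lie_br g (inJ g x a) (inJ g y b) =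
      inJ g (sl2_br x y) (op_dot a b)
      + (2%:R^-1 * kappa x y) *: inD g (op_angle a b);
  op_brJM : forall x a v m,
    lie_br g (inJ g x a) (inM g v m) =
      inM g (sl2_val x *m v) (op_bullet a m);
  op_brMM : forall v w m n,
    lie_br g (inM g v m) (inM g w n) =
      inJ g (odotV v w) (op_star m n) + det_form v w *: inD g (op_partial m n)
}.

(** * J-ternary superalgebras *)

Record isJordanSuperalgebra (K : fieldType) (J : superspace K)
    (dot : {bilinear J -> J -> J}) : Prop := IsJordanSuperalgebra {
  jordan_even : even_map2 dot;
  jordan_comm : forall p q a b, homog p a -> homog q b ->
    dot a b = (-1) ^+ (p * q) *: dot b a;
  jordan_identity : forall p q r s a b c d,
    homog p a -> homog q b -> homog r c -> homog s d ->
    dot (dot a b) (dot c d)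
    + (-1) ^+ (q * r) *: dot (dot a c) (dot b d)
    + (-1) ^+ (q * s + r * s) *: dot (dot a d) (dot b c)
    = dot (dot (dot a b) c) d
      + (-1) ^+ (q * r + q * s + r * s) *: dot (dot (dot a d) c) b
      + (-1) ^+ (p * q + p * r + p * s + r * s) *: dot (dot (dot b d) c) a
}.

Record isSpecialSupermodule (K : fieldType) (J M : superspace K)
    (dot : {bilinear J -> J -> J}) (bullet : {bilinear J -> M -> M}) : Prop :=
  IsSpecialSupermodule {
  special_even : even_map2 bullet;
  special_identity : forall p q a b m, homog p a -> homog q b ->
    bullet (dot a b) m =
      2%:R^-1 *: (bullet a (bullet b m)
                  + (-1) ^+ (p * q) *: bullet b (bullet a m))
}.

Record isJTernary (K : fieldType) (J M : superspace K)
    (dot : {bilinear J -> J -> J}) (bullet : {bilinear J -> M -> M})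
    (star : {bilinear M -> M -> J}) (tri : M -> M -> M -> M) : Prop :=
  IsJTernary {
  jt_jordan : isJordanSuperalgebra dot;
  jt_special : isSpecialSupermodule dot bullet;
  jt_star_even : even_map2 star;
  jt_star_anticomm : forall pm pn m n, homog pm m -> homog pn n ->
    star m n = - ((-1) ^+ (pm * pn) *: star n m);
  jt_tri_trilinear : trilinear tri;
  jt_tri_even : even_map3 tri;
  jt_SJT1 : forall pa pm pn a m n,
    homog pa a -> homog pm m -> homog pn n ->
    dot a (star m n) =
      2%:R^-1 *: (star (bullet a m) n
                  + (-1) ^+ (pa * pm) *: star m (bullet a n));
  jt_SJT2 : forall pa pm pn ps a m n s,
    homog pa a -> homog pm m -> homog pn n -> homog ps s ->
    bullet a (tri m n s) =
      tri (bullet a m) n s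
      - (-1) ^+ (pa * pm) *: tri m (bullet a n) s
      + (-1) ^+ (pa * (pm + pn)) *: tri m n (bullet a s);
  jt_SJT3 : forall pm pn ps m n s,
    homog pm m -> homog pn n -> homog ps s ->
    tri m n s =
      (-1) ^+ (pm * (pn + ps) + pn * ps) *: tri s n m
      - (-1) ^+ (pn * ps) *: bullet (star m s) n;
  jt_SJT4 : forall pm pn ps m n s,
    homog pm m -> homog pn n -> homog ps s ->
    tri m n s = (-1) ^+ (pm * pn) *: tri n m s + bullet (star m n) s;
  jt_SJT5 : forall pm pn pr ps m n r s,
    homog pm m -> homog pn n -> homog pr r -> homog ps s ->
    star (tri m n r) s + (-1) ^+ (pr * (pm + pn)) *: star r (tri m n s) =
      (-1) ^+ (pn * (pr + ps)) *: star m (bullet (star r s) n);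
  jt_SJT6 : forall pm pn pr ps pt m n r s t,
    homog pm m -> homog pn n -> homog pr r -> homog ps s -> homog pt t ->
    tri m n (tri r s t) =
      tri (tri m n r) s t
      + (-1) ^+ (pr * (pm + pn) + pm * pn) *: tri r (tri n m s) t
      + (-1) ^+ ((pm + pn) * (pr + ps)) *: tri r s (tri m n t)
}.

(* Main.v *)
Require Import Defs.
From HB Require Import structures.
From mathcomp Require Import all_boot all_order all_algebra.
From mathcomp Require Import complex reals.
From mathcomp Require Import ring.

Set Implicit Arguments.
Unset Strict Implicit.
Unset Printing Implicit Defensive.

Import GRing.Theory Num.Theory.
Local Open Scope ring_scope.

(** The axioms of a J-ternary superalgebra are the coordinates of the super
    skew-symmetry and of the super Jacobi identity of g, read on well-chosen
    vectors of sl_2 and of V, whose basis is (v1, v2).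

    Writing JJM for the Jacobi identity of elements of sl_2 (x) J, sl_2 (x) J,
    V (x) M, and so on, the information is distributed as follows.
    - JJM gives, on the two basis vectors of V, the values of the symmetrized
      and of the skew-symmetrized composition of a and b acting on M: the
      former is the special supermodule identity, the latter says that <a, b>
      acts on M as a quarter of the supercommutator of a and b.
    - JJJ on (e, f, h) says, in its sl_2 (x) J part, that <a, b> acts on J as
      the supercommutator of the multiplications by a and b, and, in its D
      part, that <a.b, c> = <a, b.c> + <b, a.c> up to signs.  Letting the second
      identity act on J by means of the first is the linearized Jordan identity.
    - JMM on (e, v2, v2) gives jt_SJT1 and, up to signs, computes
      d_{a m, n} - d_{m, a n} as - 2 <a, m * n>; on (h, v1, v2) it computes
      d_{m, n}(a).
    - MMM on (v1, v1, v2) is a relation between (n, s, m), (m, s, n) and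
      (m * n) s, which is jt_SJT3.  The symmetry of d and the antisymmetry of
      the star product give jt_SJT4.
    - DJM and DMM say that D acts by derivations of all the operations.

    The triple product is the operator T_{m,n} = - d_{m,n} + (m * n) / 2, and
    jt_SJT2, jt_SJT5, jt_SJT6 compare T_{m,n} with the action of J, the star
    product and the operators T_{r,s}.  In each of them the derivation rules
    move d_{m,n} inside, and the formulas for d_{m,n}(a), d_{a m, n} and <a, b>
    turn what remains into a linear identity between compositions of J and the
    star product.  The argument divides by powers of 2 and nothing else, so it is
    carried out over any field in which 2 is not zero. *)

(** * Linear identities in modules *)

(** Formal linear combinations of vectors numbered by nat: two of them with the
    same coefficients have the same value, which reduces an identity in a module
    to one scalar identity for each vector that occurs in it. *)
Inductive lin_expr (K : Type) :=
  | LinAtom of nat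
  | LinZero
  | LinAdd of lin_expr K & lin_expr K
  | LinOpp of lin_expr K
  | LinScale of K & lin_expr K.

Section LinExpr.
Variables (K : fieldType) (V : lmodType K).
Implicit Types (E : lin_expr K) (xs : seq V).

Fixpoint lin_eval xs E : V :=
  match E with
  | LinAtom i => nth 0 xs i
  | LinZero => 0
  | LinAdd E1 E2 => lin_eval xs E1 + lin_eval xs E2
  | LinOpp E1 => - lin_eval xs E1
  | LinScale c E1 => c *: lin_eval xs E1
  end.

Fixpoint lin_coef E (i : nat) : K :=
  match E with
  | LinAtom j => if i == j then 1 else 0
  | LinZero => 0
  | LinAdd E1 E2 => lin_coef E1 i + lin_coef E2 i
  | LinOpp E1 => - lin_coef E1 i
  | LinScale c E1 => c * lin_coef E1 i
  end.

Fixpoint same_coefs n E1 E2 : Prop :=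
  if n is i.+1 then lin_coef E1 i = lin_coef E2 i /\ same_coefs i E1 E2
  else True.

Lemma lin_evalE xs E :
  lin_eval xs E = \sum_(i < size xs) lin_coef E i *: nth 0 xs i.
Proof.
elim: E => [j||E1 IH1 E2 IH2|E1 IH1|c E1 IH1] /=.
- have [lt_j|le_j] := ltnP j (size xs).
    rewrite (bigD1 (Ordinal lt_j)) //= eqxx scale1r big1 ?addr0 // => i.
    by rewrite -val_eqE /= => /negPf->; rewrite scale0r.
  rewrite nth_default // big1 // => i _; case: eqP => [eq_ij|_].
    by have := ltn_ord i; rewrite eq_ij ltnNge le_j.
  by rewrite scale0r.
- by rewrite big1 // => i _; rewrite scale0r.
- by rewrite IH1 IH2 -big_split; apply: eq_bigr => i _; rewrite scalerDl.
- by rewrite IH1 -sumrN; apply: eq_bigr => i _; rewrite scaleNr.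
- by rewrite IH1 scaler_sumr; apply: eq_bigr => i _; rewrite scalerA.
Qed.

Lemma lin_eval_eq xs E1 E2 :
  same_coefs (size xs) E1 E2 -> lin_eval xs E1 = lin_eval xs E2.
Proof.
move=> eqE; rewrite !lin_evalE; apply: eq_bigr => i _; congr (_ *: _).
case: i => i /=; elim: (size xs) eqE => //= n IH [eq_n eqE].
by rewrite ltnS leq_eqVlt => /predU1P[->//|]; exact: IH.
Qed.

Lemma eq_from_lincomb (c : K) (x y u v : V) :
  u = v -> x - y = c *: (u - v) -> x = y.
Proof.
by move=> ->; rewrite subrr scaler0 => /eqP; rewrite subr_eq0 => /eqP.
Qed.

Lemma eq_from_lincomb2 (c c' : K) (x y u v u' v' : V) :
  u = v -> u' = v' -> x - y = c *: (u - v) + c' *: (u' - v') -> x = y.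
Proof.
move=> -> ->; rewrite !subrr !scaler0 addr0 => /eqP.
by rewrite subr_eq0 => /eqP.
Qed.

End LinExpr.

Ltac lin_index x xs :=
  lazymatch xs with
  | x :: _ => constr:(0%N)
  | _ :: ?ys => let i := lin_index x ys in constr:(i.+1)
  end.

Ltac lin_atoms x xs :=
  lazymatch x with
  | (?a + ?b)%R => let ys := lin_atoms a xs in lin_atoms b ys
  | (- ?a)%R => lin_atoms a xs
  | (_ *: ?a)%R => lin_atoms a xs
  | 0%R => xs
  | _ => match xs with
         | _ => let i := lin_index x xs in xs
         | _ => constr:(x :: xs)
         end
  end.

Ltac lin_quote K x xs :=
  lazymatch x with
  | (?a + ?b)%R =>
    let E := lin_quote K a xs in let F := lin_quote K b xs in
    constr:(@LinAdd K E F)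
  | (- ?a)%R => let E := lin_quote K a xs in constr:(@LinOpp K E)
  | (?c *: ?a)%R => let E := lin_quote K a xs in constr:(@LinScale K c E)
  | 0%R => constr:(@LinZero K)
  | _ => let i := lin_index x xs in constr:(@LinAtom K i)
  end.

Ltac compare_coefs K :=
  lazymatch goal with
  | |- @eq ?V ?x ?y =>
    let xs := lin_atoms x (@nil V) in
    let xs := lin_atoms y xs in
    let E := lin_quote K x xs in
    let F := lin_quote K y xs in
    apply: (@lin_eval_eq K _ xs E F); repeat split; rewrite /=
  end.

Section LinearMaps.
Variables (K : fieldType) (U V W : lmodType K).

(** Linearity of one given map as a rewrite rule: the generic rules loop, since
    they also apply to the scaling operation that they produce. *)
Lemma linear_mapE (F : {linear U -> V}) :
  ((forall x y, (F (x + y) = F x + F y)%R) * (forall x, (F (- x) = - F x)%R)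
   * (forall c x, (F (c *: x) = c *: F x)%R))%type.
Proof. by split; [split|]; [exact: raddfD|exact: raddfN|exact: linearZ_LR]. Qed.

Lemma bilinear_mapE (F : {bilinear U -> V -> W}) :
  ((forall x y z, (F (x + y) z = F x z + F y z)%R)
   * (forall x z, (F (- x) z = - F x z)%R)
   * (forall c x z, (F (c *: x) z = c *: F x z)%R)
   * (forall x y z, (F x (y + z) = F x y + F x z)%R)
   * (forall x z, (F x (- z) = - F x z)%R)
   * (forall c x z, (F x (c *: z) = c *: F x z)%R))%type.
Proof.
split=> [|c x z]; last exact: linearZr_LR.
split=> [|x z]; last exact: linearNr.
split=> [|x y z]; last exact: linearDr.
split=> [|c x z]; last exact: linearZl_LR.
by split=> [x y z|x z]; [exact: linearDl|exact: linearNl].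
Qed.

End LinearMaps.

(** * Computations in sl_2 and its natural representation *)

Lemma det_mx22 (K : fieldType) (A : 'M[K]_2) :
  \det A = A 0 0 * A 1 1 - A 0 1 * A 1 0.
Proof.
rewrite (expand_det_row _ 0) !big_ord_recl big_ord0 /cofactor !det_mx11 !mxE /=.
have l00 : lift 0 0 = 1 :> 'I_2 by exact: val_inj.
have l10 : lift 1 0 = 0 :> 'I_2 by exact: val_inj.
by rewrite !l00 l10 expr0 expr1 mul1r mulN1r mulrN addr0.
Qed.

Lemma det_formE (K : fieldType) (v w : 'cV[K]_2) :
  det_form v w = v 0 0 * w 1 0 - v 1 0 * w 0 0.
Proof.
have row0 i : row_mx v w i 0 = v i 0.
  by rewrite -(row_mxEl v w); congr (row_mx v w i _); apply: val_inj.
have row1 i : row_mx v w i 1 = w i 0.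
  by rewrite -(row_mxEr v w); congr (row_mx v w i _); apply: val_inj.
by rewrite /det_form det_mx22 !(row0, row1) [w 0 0 * _]mulrC.
Qed.

Section Sl2.
Variable K : fieldType.
Local Notation e := (sl2_e K).
Local Notation f := (sl2_f K).
Local Notation h := (sl2_h K).

Lemma odotV_entry (v w : 'cV[K]_2) i j :
  sl2_val (odotV v w) i j =
    v 0 0 * w 0 0 * sl2_val e i j
    - 2%:R^-1 * (v 0 0 * w 1 0 + v 1 0 * w 0 0) * sl2_val h i j
    - v 1 0 * w 1 0 * sl2_val f i j.
Proof.
have valB (x y : sl2 K) : sl2_val (x - y) = sl2_val x - sl2_val y by [].
have valZ c (x : sl2 K) : sl2_val (c *: x) = c *: sl2_val x by [].
by rewrite !(valB, valZ, mxE).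
Qed.

Lemma sl2_valZ c (x : sl2 K) i j : sl2_val (c *: x) i j = c * sl2_val x i j.
Proof.
by have -> : sl2_val (c *: x) = c *: sl2_val x by []; rewrite mxE.
Qed.

Lemma sl2_val0 i j : sl2_val (0 : sl2 K) i j = 0.
Proof. by rewrite -[0](scale0r 0) sl2_valZ mul0r. Qed.

Ltac sl2_compute :=
  apply/val_inj/matrixP => -[[|[|//]] ?] [[|[|//]] ?];
  rewrite /= ?sl2_valZ !(mxE, big_ord_recl, big_ord0) /=; ring.

Lemma sl2_br_ef : sl2_br e f = h.
Proof. by sl2_compute. Qed.

Lemma sl2_br_eh : sl2_br e h = (- 2%:R) *: e.
Proof. by sl2_compute. Qed.

Lemma sl2_br_fh : sl2_br f h = 2%:R *: f.
Proof. by sl2_compute. Qed.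

Lemma sl2_br_fe : sl2_br f e = (- 1) *: h.
Proof. by sl2_compute. Qed.

Lemma sl2_br_hh : sl2_br h h = 0.
Proof. by apply: val_inj; rewrite /= subrr. Qed.

Lemma sl2_brZr c (x y : sl2 K) : sl2_br x (c *: y) = c *: sl2_br x y.
Proof.
by apply: val_inj => /=; rewrite -scalemxAl -scalemxAr scalerBr.
Qed.

Ltac kappa_compute :=
  rewrite /kappa /mxtrace !(mxE, big_ord_recl, big_ord0) /=; ring.

Lemma kappa_ef : kappa e f = 4%:R.
Proof. by kappa_compute. Qed.

Lemma kappa_fe : kappa f e = 4%:R.
Proof. by kappa_compute. Qed.

Lemma kappa_eh : kappa e h = 0.
Proof. by kappa_compute. Qed.

Lemma kappa_fh : kappa f h = 0.
Proof. by kappa_compute. Qed.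

Lemma kappa_hh : kappa h h = 8%:R.
Proof. by kappa_compute. Qed.

Lemma kappaZr c (x y : sl2 K) : kappa x (c *: y) = c * kappa x y.
Proof. by rewrite /kappa /= -scalemxAr mxtraceZ mulrCA. Qed.

End Sl2.

(** * Coordinates on a short sl_2-Lie superalgebra *)

Section Coordinates.
Variable K : fieldType.

(** A linear form phi on U induces the map phi (x) id on U (x) W. *)
Lemma tensor_coordinate (U W T : lmodType K) (t : {bilinear U -> W -> T})
    (phi : U -> K) :
  is_tensor_product t -> scalar phi ->
  exists F : {linear T -> W}, forall u w, F (t u w) = phi u *: w.
Proof.
move=> tP phi_lin; pose b u (w : W) := phi u *: w.
have b_bil : bilinear_for *:%R *:%R b.
  split=> [w c u u'|u c w w']; rewrite /b.
    by rewrite phi_lin scalerDl -scalerA.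
  by rewrite scalerDr scalerA mulrC -scalerA.
pose bP := bilinear_isBilinear.Build K U W W *:%R *:%R b b_bil.
pose B : {bilinear U -> W -> W} := HB.pack b bP.
by have [F FE _] := tP W B; exists F.
Qed.

Variables (J M D : superspace K) (g : shortSl2 J M D).

Lemma short_dec_inverse :
  exists2 G : {linear g -> (short_sl2J g * short_VM g * D)%type},
    cancel (short_dec g) G & cancel G (short_dec g).
Proof.
have [G decK GK] := short_dec_bij g.
have G_lin : linear G by apply: (can2_linear decK GK).
pose GP := GRing.isLinear.Build _ _ _ _ G G_lin.
pose G' : {linear g -> (short_sl2J g * short_VM g * D)%type} := HB.pack G GP.
by exists G'.
Qed.

Lemma coordinateJ (i j : 'I_2) : exists F : {linear g -> J},
  [/\ forall x a, F (inJ g x a) = sl2_val x i j *: a,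
      forall v m, F (inM g v m) = 0 & forall d, F (inD g d) = 0].
Proof.
have [F FE] : exists F : {linear short_sl2J g -> J},
    forall x a, F (short_tJ g x a) = sl2_val x i j *: a.
  apply: (tensor_coordinate (phi := fun x => sl2_val x i j)) (short_tJP g) _.
  by move=> c x y; rewrite /= !mxE.
have [G decK _] := short_dec_inverse.
exists (F \o fst \o fst \o G)%FUN.
by split=> [x a|v m|d]; rewrite /= decK /= ?linear0 ?FE.
Qed.

Lemma coordinateM (i : 'I_2) : exists F : {linear g -> M},
  [/\ forall x a, F (inJ g x a) = 0,
      forall v m, F (inM g v m) = v i 0 *: m & forall d, F (inD g d) = 0].
Proof.
have [F FE] : exists F : {linear short_VM g -> M},
    forall v m, F (short_tM g v m) = v i 0 *: m.
  apply: (tensor_coordinate (phi := fun v : 'cV[K]_2 => v i 0))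
    (short_tMP g) _.
  by move=> c x y; rewrite /= !mxE.
have [G decK _] := short_dec_inverse.
exists (F \o snd \o fst \o G)%FUN.
by split=> [x a|v m|d]; rewrite /= decK /= ?linear0 ?FE.
Qed.

Lemma coordinateD : exists F : {linear g -> D},
  [/\ forall x a, F (inJ g x a) = 0,
      forall v m, F (inM g v m) = 0 & forall d, F (inD g d) = d].
Proof.
have [G decK _] := short_dec_inverse.
exists (snd \o G)%FUN.
by split=> [x a|v m|d]; rewrite /= decK.
Qed.

Lemma inJ_comb x c a b : inJ g x (c *: a + b) = c *: inJ g x a + inJ g x b.
Proof.
rewrite /inJ -linearP linearPr; congr (short_dec g _).
by do 2?[apply: injective_projections]; rewrite /= ?scaler0 ?addr0.
Qed.

End Coordinates.

Section ShortLie.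
Variables (K : fieldType).
Hypothesis two_neq0 : 2%:R != 0 :> K.
Variables (J M D : superspace K) (g : shortSl2 J M D) (ops : shortOps g).

Local Notation e := (sl2_e K).
Local Notation f := (sl2_f K).
Local Notation h := (sl2_h K).
Local Notation v1 := (delta_mx 0 0 : 'cV[K]_2).
Local Notation v2 := (delta_mx 1 0 : 'cV[K]_2).
Local Notation inJ := (inJ g).
Local Notation inM := (inM g).
Local Notation inD := (inD g).
Local Notation br := (lie_br g).
Local Notation dJ := (op_dJ ops).
Local Notation dM := (op_dM ops).
Local Notation dot := (op_dot ops).
Local Notation bullet := (op_bullet ops).
Local Notation star := (op_star ops).
Local Notation angle := (op_angle ops).
Local Notation partial := (op_partial ops).
Local Notation tri m n s :=
  (- dM (partial m n) s + 2%:R^-1 *: bullet (star m n) s).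

Let brE := (op_brDJ ops, op_brDM ops, op_brJJ ops, op_brJM ops, op_brMM ops).
Let signE := (mulnDl, mulnDr, exprD, mul0n, muln0, mul1n, muln1, expr0, expr1).
Let entryE := (odotV_entry, @mxE, big_ord_recl, big_ord0, det_formE).
Let sl2E := (sl2_brZr, kappaZr, sl2_br_ef, sl2_br_eh, sl2_br_fh, sl2_br_fe,
  sl2_br_hh, kappa_ef, kappa_fe, kappa_eh, kappa_fh, kappa_hh).
Let scalarE := (mulr0, mul0r, mulr1, mul1r, addr0, add0r, subr0, sub0r, oppr0,
  @opprK, scale0r, scale1r, scaler0).

Lemma four_neq0 : 4%:R != 0 :> K.
Proof. by rewrite -[4%N]/(2 * 2)%N natrM mulf_neq0. Qed.

(** A sign with variable parities is an opaque scalar here; where signs have to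
    be multiplied, a case analysis on the parities makes them numerals first. *)
Ltac linear_arith :=
  compare_coefs K; rewrite ?signE; field; rewrite ?two_neq0 ?four_neq0 //.

(** Applies the coordinate F to an identity in g whose vectors of sl_2 and V are
    concrete, and evaluates their entries. *)
Ltac read_coordinate F FJ FM FD :=
  rewrite ?sl2E !(linear_mapE F) !(FJ, FM, FD) ?sl2_valZ ?sl2_val0
    /kappa /mxtrace ?entryE /= ?entryE /= !scalarE.

(** * Skew-symmetry *)

Lemma homog_inJ p x a : homog p a -> homog p (inJ x a).
Proof. exact: short_dec_homogJ. Qed.

Lemma homog_inM p v m : homog p m -> homog p (inM v m).
Proof. exact: short_dec_homogM. Qed.

Lemma homog_inD p d : homog p d -> homog p (inD d).
Proof. exact: short_dec_homogD. Qed.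

Lemma br_skew p q x y : homog p x -> homog q y ->
  br y x = - ((-1) ^+ (p * q) *: br x y).
Proof. by move=> hx hy; rewrite (lie_br_skew hy hx) mulnC. Qed.

Lemma brJD p q x a d : homog p a -> homog q d ->
  br (inJ x a) (inD d) = - ((-1) ^+ (p * q) *: inJ x (dJ d a)).
Proof.
move=> ha hd.
by rewrite (br_skew (homog_inD hd) (homog_inJ x ha)) (op_brDJ ops) mulnC.
Qed.

Lemma brMD p q v m d : homog p m -> homog q d ->
  br (inM v m) (inD d) = - ((-1) ^+ (p * q) *: inM v (dM d m)).
Proof.
move=> hm hd.
by rewrite (br_skew (homog_inD hd) (homog_inM v hm)) (op_brDM ops) mulnC.
Qed.

Lemma brMJ p q v m x a : homog p m -> homog q a ->
  br (inM v m) (inJ x a) =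
    - ((-1) ^+ (p * q) *: inM (sl2_val x *m v) (bullet a m)).
Proof.
move=> hm ha.
by rewrite (br_skew (homog_inJ x ha) (homog_inM v hm)) (op_brJM ops) mulnC.
Qed.

(** [e, f] = h is skew-symmetric, so the sign of the bracket cancels. *)
Lemma op_dot_comm p q a b : homog p a -> homog q b ->
  dot a b = (-1) ^+ (p * q) *: dot b a.
Proof.
move=> ha hb; have [F [FJ FM FD]] := coordinateJ g 0 0.
have /(congr1 F) := br_skew (homog_inJ f hb) (homog_inJ e ha).
rewrite !brE; read_coordinate F FJ FM FD => E.
apply: (@eq_from_lincomb _ _ 1 _ _ _ _ E).
by case: p q {ha hb E} => [] []; linear_arith.
Qed.

(** The star product inherits the sign of the bracket because the map from
    V x V to sl_2 is symmetric, here with value e on (v1, v1). *)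
Lemma op_star_anticomm p q m n : homog p m -> homog q n ->
  star m n = - ((-1) ^+ (p * q) *: star n m).
Proof.
move=> hm hn; have [F [FJ FM FD]] := coordinateJ g 0 1.
have /(congr1 F) := br_skew (homog_inM v1 hn) (homog_inM v1 hm).
rewrite !brE; read_coordinate F FJ FM FD => E.
apply: (@eq_from_lincomb _ _ 1 _ _ _ _ E).
by case: p q {hm hn E} => [] []; linear_arith.
Qed.

Lemma op_partial_comm p q m n : homog p m -> homog q n ->
  partial m n = (-1) ^+ (p * q) *: partial n m.
Proof.
move=> hm hn; have [F [FJ FM FD]] := coordinateD g.
have /(congr1 F) := br_skew (homog_inM v2 hn) (homog_inM v1 hm).
rewrite !brE; read_coordinate F FJ FM FD => E.
apply: (@eq_from_lincomb _ _ 1 _ _ _ _ E).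
by case: p q {hm hn E} => [] []; linear_arith.
Qed.

(** * The action of J on M *)

Lemma jacobiJJM p q x y v a b m : homog p a -> homog q b ->
  inM (sl2_val x *m (sl2_val y *m v)) (bullet a (bullet b m)) =
    inM (sl2_val (sl2_br x y) *m v) (bullet (dot a b) m)
    + (2%:R^-1 * kappa x y) *: inM v (dM (angle a b) m)
    + (-1) ^+ (p * q) *:
        inM (sl2_val y *m (sl2_val x *m v)) (bullet b (bullet a m)).
Proof.
move=> ha hb.
have := lie_br_jacobi (inM v m) (homog_inJ x ha) (homog_inJ y hb).
by rewrite !brE !(bilinear_mapE br) !brE.
Qed.

(** The product f e kills v1, so only one of the two orders of a and b survives
    there; on v2, killed by e f, it is the other one that does. *)
Lemma bullet_bullet p q a b m : homog p a -> homog q b ->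
  bullet a (bullet b m) = bullet (dot a b) m + 2%:R *: dM (angle a b) m.
Proof.
move=> ha hb; have [F [FJ FM FD]] := coordinateM g 0.
have /(congr1 F) := jacobiJJM e f v1 m ha hb.
read_coordinate F FJ FM FD => E.
by apply: (@eq_from_lincomb _ _ 1 _ _ _ _ E); linear_arith.
Qed.

Lemma bullet_bullet_swap p q a b m : homog p a -> homog q b ->
  (-1) ^+ (p * q) *: bullet b (bullet a m) =
    bullet (dot a b) m - 2%:R *: dM (angle a b) m.
Proof.
move=> ha hb; have [F [FJ FM FD]] := coordinateM g 1.
have /(congr1 F) := jacobiJJM e f v2 m ha hb.
read_coordinate F FJ FM FD => E.
by apply: (@eq_from_lincomb _ _ (-1) _ _ _ _ E); linear_arith.
Qed.

Lemma op_bullet_special p q a b m : homog p a -> homog q b ->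
  bullet (dot a b) m =
    2%:R^-1 *: (bullet a (bullet b m)
                + (-1) ^+ (p * q) *: bullet b (bullet a m)).
Proof.
move=> ha hb; rewrite (bullet_bullet m ha hb) (bullet_bullet_swap m ha hb).
by linear_arith.
Qed.

Lemma op_dM_angle p q a b m : homog p a -> homog q b ->
  dM (angle a b) m =
    4%:R^-1 *: (bullet a (bullet b m)
                - (-1) ^+ (p * q) *: bullet b (bullet a m)).
Proof.
move=> ha hb; rewrite (bullet_bullet m ha hb) (bullet_bullet_swap m ha hb).
by linear_arith.
Qed.

(** * The Jordan identity *)

Lemma jacobiJJJ p q r x y z a b c : homog p a -> homog q b -> homog r c ->
  inJ (sl2_br x (sl2_br y z)) (dot a (dot b c))
  + (2%:R^-1 * kappa x (sl2_br y z)) *: inD (angle a (dot b c))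
  - (2%:R^-1 * kappa y z * (-1) ^+ (p * (q (+) r))) *:
      inJ x (dJ (angle b c) a) =
  inJ (sl2_br (sl2_br x y) z) (dot (dot a b) c)
  + (2%:R^-1 * kappa (sl2_br x y) z) *: inD (angle (dot a b) c)
  + (2%:R^-1 * kappa x y) *: inJ z (dJ (angle a b) c)
  + (-1) ^+ (p * q) *:
      (inJ (sl2_br y (sl2_br x z)) (dot b (dot a c))
       + (2%:R^-1 * kappa y (sl2_br x z)) *: inD (angle b (dot a c))
       - (2%:R^-1 * kappa x z * (-1) ^+ (q * (p (+) r))) *:
           inJ y (dJ (angle a c) b)).
Proof.
move=> ha hb hc.
have := lie_br_jacobi (inJ z c) (homog_inJ x ha) (homog_inJ y hb).
rewrite !brE !(bilinear_mapE br) !brE.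
rewrite (brJD _ ha (op_angle_even ops hb hc)).
by rewrite (brJD _ hb (op_angle_even ops ha hc)) !scalerN !scalerA.
Qed.

(** Of kappa(e, f), kappa(e, h) and kappa(f, h) only the first is nonzero, and
    [[e, f], h] = 0, so that <a, c>, <b, c> and (a.b).c disappear. *)
Lemma op_dJ_angle p q r a b c : homog p a -> homog q b -> homog r c ->
  dJ (angle a b) c = dot a (dot b c) - (-1) ^+ (p * q) *: dot b (dot a c).
Proof.
move=> ha hb hc; have [F [FJ FM FD]] := coordinateJ g 0 0.
have /(congr1 F) := jacobiJJJ e f h ha hb hc.
read_coordinate F FJ FM FD => E.
apply: (@eq_from_lincomb _ _ (- 2%:R^-1) _ _ _ _ E).
by case: p q r {ha hb hc E} => [] [] []; linear_arith.
Qed.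

Lemma op_angle_dot p q r a b c : homog p a -> homog q b -> homog r c ->
  angle (dot a b) c =
    angle a (dot b c) + (-1) ^+ (p * q) *: angle b (dot a c).
Proof.
move=> ha hb hc; have [F [FJ FM FD]] := coordinateD g.
have /(congr1 F) := jacobiJJJ e f h ha hb hc.
read_coordinate F FJ FM FD => E.
apply: (@eq_from_lincomb _ _ (- 4%:R^-1) _ _ _ _ E).
by case: p q r {ha hb hc E} => [] [] []; linear_arith.
Qed.

(** Up to signs, the linearized Jordan identity, applied to c, says that the
    supercommutators [L_{ab}, L_d], [L_{bd}, L_a] and [L_{da}, L_b] add up to
    zero: these are the actions of <a.b, d>, <b.d, a> and <d.a, b>. *)
Lemma op_dot_jordan p q r s a b c d :
  homog p a -> homog q b -> homog r c -> homog s d ->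
  dot (dot a b) (dot c d)
  + (-1) ^+ (q * r) *: dot (dot a c) (dot b d)
  + (-1) ^+ (q * s + r * s) *: dot (dot a d) (dot b c)
  = dot (dot (dot a b) c) d
    + (-1) ^+ (q * r + q * s + r * s) *: dot (dot (dot a d) c) b
    + (-1) ^+ (p * q + p * r + p * s + r * s) *: dot (dot (dot b d) c) a.
Proof.
move=> ha hb hc hd.
have hab := op_dot_even ops ha hb; have hac := op_dot_even ops ha hc.
have had := op_dot_even ops ha hd; have hbd := op_dot_even ops hb hd.
have /(congr1 (fun d0 => dJ d0 c)) /= := op_angle_dot ha hb hd.
rewrite !(bilinear_mapE dJ) (op_dJ_angle hab hd hc).
rewrite (op_dJ_angle ha hbd hc) (op_dJ_angle hb had hc).
(* Reordering the factors so that only the products of the goal occur. *)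
rewrite (op_dot_comm hd hc) !(bilinear_mapE dot) (op_dot_comm hbd hac).
rewrite (op_dot_comm hd (op_dot_even ops hab hc)).
rewrite (op_dot_comm ha (op_dot_even ops hbd hc)).
rewrite (op_dot_comm hb (op_dot_even ops had hc)) => E.
apply: (@eq_from_lincomb _ _ ((-1) ^+ (r * s)) _ _ _ _ E).
by case: p q r s {ha hb hc hd hab hac had hbd E} => [] [] [] []; linear_arith.
Qed.

(** * The action of J on the star product *)

Lemma jacobiJMM p q r x v w a m n : homog p a -> homog q m -> homog r n ->
  inJ (sl2_br x (odotV v w)) (dot a (star m n))
  + (2%:R^-1 * kappa x (odotV v w)) *: inD (angle a (star m n))
  - (det_form v w * (-1) ^+ (p * (q (+) r))) *: inJ x (dJ (partial m n) a) =
  inJ (odotV (sl2_val x *m v) w) (star (bullet a m) n)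
  + det_form (sl2_val x *m v) w *: inD (partial (bullet a m) n)
  + (-1) ^+ (p * q) *:
      (inJ (odotV v (sl2_val x *m w)) (star m (bullet a n))
       + det_form v (sl2_val x *m w) *: inD (partial m (bullet a n))).
Proof.
move=> ha hm hn.
have := lie_br_jacobi (inM w n) (homog_inJ x ha) (homog_inM v hm).
rewrite !brE !(bilinear_mapE br) !brE.
by rewrite (brJD _ ha (op_partial_even ops hm hn)) !scalerN !scalerA.
Qed.

(** The determinant vanishes on (v2, v2), which removes the term d_{m,n}(a). *)
Lemma op_star_bullet p q r a m n : homog p a -> homog q m -> homog r n ->
  dot a (star m n) =
    2%:R^-1 *: (star (bullet a m) n + (-1) ^+ (p * q) *: star m (bullet a n)).
Proof.
move=> ha hm hn; have [F [FJ FM FD]] := coordinateJ g 0 0.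
have /(congr1 F) := jacobiJMM e v2 v2 ha hm hn.
read_coordinate F FJ FM FD => E.
by apply: (@eq_from_lincomb _ _ (-1) _ _ _ _ E); linear_arith.
Qed.

Lemma op_partial_bullet p q r a m n : homog p a -> homog q m -> homog r n ->
  partial (bullet a m) n =
    (-1) ^+ (p * q) *: partial m (bullet a n) - 2%:R *: angle a (star m n).
Proof.
move=> ha hm hn; have [F [FJ FM FD]] := coordinateD g.
have /(congr1 F) := jacobiJMM e v2 v2 ha hm hn.
read_coordinate F FJ FM FD => E.
by apply: (@eq_from_lincomb _ _ (-1) _ _ _ _ E); linear_arith.
Qed.

(** The image of (v1, v2) in sl_2 is a multiple of h, so that bracketing with h
    removes a.(m * n) and leaves d_{m,n}(a). *)
Lemma op_dJ_partial p q r a m n : homog p a -> homog q m -> homog r n ->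
  dJ (partial m n) a =
    ((-1) ^+ (p * (q + r)) * 2%:R^-1) *:
      (star (bullet a m) n - (-1) ^+ (p * q) *: star m (bullet a n)).
Proof.
move=> ha hm hn; have [F [FJ FM FD]] := coordinateJ g 0 0.
have /(congr1 F) := jacobiJMM h v1 v2 ha hm hn.
read_coordinate F FJ FM FD => E.
apply: (@eq_from_lincomb _ _ (- (-1) ^+ (p * (q + r))) _ _ _ _ E).
by case: p q r {ha hm hn E} => [] [] []; linear_arith.
Qed.

(** * Symmetries of the triple product *)

Lemma jacobiMMM p q r u v w m n s : homog p m -> homog q n -> homog r s ->
  - ((-1) ^+ (p * (q (+) r)) *:
       (inM (sl2_val (odotV v w) *m u) (bullet (star n s) m)
        + det_form v w *: inM u (dM (partial n s) m))) =
  inM (sl2_val (odotV u v) *m w) (bullet (star m n) s)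
  + det_form u v *: inM w (dM (partial m n) s)
  - ((-1) ^+ (p * q) * (-1) ^+ (q * (p (+) r))) *:
       (inM (sl2_val (odotV u w) *m v) (bullet (star m s) n)
        + det_form u w *: inM v (dM (partial m s) n)).
Proof.
move=> hm hn hs.
have := lie_br_jacobi (inM w s) (homog_inM u hm) (homog_inM v hn).
rewrite !brE !(bilinear_mapE br) !brE.
rewrite (brMJ _ _ hm (op_star_even ops hn hs)).
rewrite (brMJ _ _ hn (op_star_even ops hm hs)).
rewrite (brMD _ hm (op_partial_even ops hn hs)).
rewrite (brMD _ hn (op_partial_even ops hm hs)) => E.
by apply: (@eq_from_lincomb _ _ 1 _ _ _ _ E); linear_arith.
Qed.

(** The image of (v1, v2) in sl_2 is - h / 2 and its determinant is 1: on v1 the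
    two parts of the bracket combine into exactly the triple product. *)
Lemma tri_jacobi p q r m n s : homog p m -> homog q n -> homog r s ->
  (-1) ^+ (p * (q + r)) *: tri n s m =
    bullet (star m n) s + (-1) ^+ (q * r) *: tri m s n.
Proof.
move=> hm hn hs; have [F [FJ FM FD]] := coordinateM g 0.
have /(congr1 F) := jacobiMMM v1 v1 v2 hm hn hs.
read_coordinate F FJ FM FD => E.
apply: (@eq_from_lincomb _ _ 1 _ _ _ _ E).
by case: p q r {hm hn hs E} => [] [] []; linear_arith.
Qed.

Lemma tri_swap13 p q r m n s : homog p m -> homog q n -> homog r s ->
  tri m n s =
    (-1) ^+ (p * (q + r) + q * r) *: tri s n m
    - (-1) ^+ (q * r) *: bullet (star m s) n.
Proof.
move=> hm hn hs; have E := tri_jacobi hm hs hn.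
apply: (@eq_from_lincomb _ _ (- (-1) ^+ (q * r)) _ _ _ _ E).
by case: p q r {hm hn hs E} => [] [] []; linear_arith.
Qed.

Lemma tri_swap12 p q m n s : homog p m -> homog q n ->
  tri m n s = (-1) ^+ (p * q) *: tri n m s + bullet (star m n) s.
Proof.
move=> hm hn; rewrite (op_partial_comm hm hn) (op_star_anticomm hm hn).
rewrite !(bilinear_mapE dM, bilinear_mapE bullet).
by case: p q {hm hn} => [] []; linear_arith.
Qed.

(** * D acts by derivations *)

Lemma op_dM_bullet p q d a m : homog p d -> homog q a ->
  dM d (bullet a m) =
    bullet (dJ d a) m + (-1) ^+ (p * q) *: bullet a (dM d m).
Proof.
move=> hd ha; have [F [FJ FM FD]] := coordinateM g 0.
have := lie_br_jacobi (inM v2 m) (homog_inD hd) (homog_inJ e ha).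
by rewrite !brE => /(congr1 F); read_coordinate F FJ FM FD.
Qed.

Lemma jacobiDMM p q v w d m n : homog p d -> homog q m ->
  inJ (odotV v w) (dJ d (star m n))
  + det_form v w *: br (inD d) (inD (partial m n)) =
  inJ (odotV v w) (star (dM d m) n) + det_form v w *: inD (partial (dM d m) n)
  + (-1) ^+ (p * q) *:
      (inJ (odotV v w) (star m (dM d n))
       + det_form v w *: inD (partial m (dM d n))).
Proof.
move=> hd hm.
have := lie_br_jacobi (inM w n) (homog_inD hd) (homog_inM v hm).
by rewrite !brE !(bilinear_mapE br) !brE.
Qed.

Lemma op_dJ_star p q d m n : homog p d -> homog q m ->
  dJ d (star m n) = star (dM d m) n + (-1) ^+ (p * q) *: star m (dM d n).
Proof.
move=> hd hm; have [F [FJ FM FD]] := coordinateJ g 0 1.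
have /(congr1 F) := jacobiDMM v1 v1 n hd hm.
by read_coordinate F FJ FM FD.
Qed.

(** The bracket of D is not one of the operations, so that this derivation rule
    is an identity in g rather than in D. *)
Lemma brD_partial p q d m n : homog p d -> homog q m ->
  br (inD d) (inD (partial m n)) =
    inD (partial (dM d m) n) + (-1) ^+ (p * q) *: inD (partial m (dM d n)).
Proof.
move=> hd hm; have := jacobiDMM v1 v2 n hd hm.
rewrite (op_dJ_star n hd hm) [star _ _ + _]addrC inJ_comb.
rewrite (_ : det_form v1 v2 = 1) => [E|]; last by rewrite !entryE /= !scalarE.
by apply: (@eq_from_lincomb _ _ 1 _ _ _ _ E); linear_arith.
Qed.

Lemma op_dM_partial p q r d m n s : homog p d -> homog q m -> homog r n ->
  dM d (dM (partial m n) s) =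
    dM (partial (dM d m) n) s + (-1) ^+ (p * q) *: dM (partial m (dM d n)) s
    + (-1) ^+ (p * (q + r)) *: dM (partial m n) (dM d s).
Proof.
move=> hd hm hn; have [F [FJ FM FD]] := coordinateM g 0.
have := lie_br_jacobi (inM v1 s) (homog_inD hd)
  (homog_inD (op_partial_even ops hm hn)).
rewrite (brD_partial _ hd hm) !(bilinear_mapE br) !brE.
move=> /(congr1 F); read_coordinate F FJ FM FD => E.
apply: (@eq_from_lincomb _ _ 1 _ _ _ _ E).
by case: p q r {hd hm hn E} => [] [] []; linear_arith.
Qed.

(** * Derivation rules for the triple product *)

Lemma tri_trilinear : trilinear (fun m n s => tri m n s).
Proof.
split=> [n s|m s|m n] c x y;
  rewrite !(bilinear_mapE partial, bilinear_mapE star, bilinear_mapE dM,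
            bilinear_mapE bullet); by linear_arith.
Qed.

Lemma tri_even : even_map3 (fun m n s => tri m n s).
Proof.
move=> p q r m n s hm hn hs.
have hd := op_dM_even ops (op_partial_even ops hm hn) hs.
have hb := op_bullet_even ops (op_star_even ops hm hn) hs.
have := homogP (-1) hd (homogP 2%:R^-1 hb (homog0 _ _)).
by rewrite scaleN1r addr0.
Qed.

(** The defect d_{a m, n} - d_{m, a n} = - 2 <a, m * n> acts on M as minus half
    the supercommutator of a and m * n, which is what moving a through
    (m * n) s / 2 requires. *)
Lemma tri_bullet p q r t a m n s :
  homog p a -> homog q m -> homog r n -> homog t s ->
  bullet a (tri m n s) =
    tri (bullet a m) n s
    - (-1) ^+ (p * q) *: tri m (bullet a n) s
    + (-1) ^+ (p * (q + r)) *: tri m n (bullet a s).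
Proof.
move=> ha hm hn hs.
rewrite (op_partial_bullet ha hm hn).
rewrite (op_dM_bullet s (op_partial_even ops hm hn) ha).
rewrite (op_dJ_partial ha hm hn).
rewrite !(bilinear_mapE bullet, bilinear_mapE dM).
rewrite (op_dM_angle s ha (op_star_even ops hm hn)).
by case: p q r {ha hm hn} => [] [] []; linear_arith.
Qed.

(** With c = k * s, the left-hand side is c.(m * n) - d_{m,n}(c) up to signs.
    These are half the sum and half the difference of (c m) * n and m * (c n), so
    only the latter remains. *)
Lemma tri_star p q r t m n k s :
  homog p m -> homog q n -> homog r k -> homog t s ->
  star (tri m n k) s + (-1) ^+ (r * (p + q)) *: star k (tri m n s) =
    (-1) ^+ (q * (r + t)) *: star m (bullet (star k s) n).
Proof.
move=> hm hn hk hs.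
have hmn := op_star_even ops hm hn; have hks := op_star_even ops hk hs.
have Ed := op_dJ_star s (op_partial_even ops hm hn) hk.
rewrite (op_dJ_partial hks hm hn) in Ed.
have Es := op_star_bullet hmn hk hs.
rewrite (op_dot_comm hmn hks) (op_star_bullet hks hm hn) in Es.
rewrite !(bilinear_mapE star).
apply: (@eq_from_lincomb2 _ _ 1 (-1) _ _ _ _ _ _ Ed Es).
by case: p q r t {hm hn hk hs hmn hks Ed Es} => [] [] [] []; linear_arith.
Qed.

(** Put b = m * n and c = r * s.  The supercommutator of T_{m,n} and T_{r,s} has
    four parts: that of d_{m,n} and d_{r,s}, given by the derivation rule for d;
    the actions on M of d_{m,n}(c) / 2 and d_{r,s}(b) / 2, given by the
    derivation rule for the star product and the formula for d_{r,s}(b); and a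
    quarter of that of b and c, which is the action of <b, c>.  On the right-hand
    side <b, c> arises as half the defect d_{r, b s} - d_{b r, s}. *)
Lemma tri_tri pm pn pr ps m n r s t :
  homog pm m -> homog pn n -> homog pr r -> homog ps s ->
  tri m n (tri r s t) =
    tri (tri m n r) s t
    + (-1) ^+ (pr * (pm + pn) + pm * pn) *: tri r (tri n m s) t
    + (-1) ^+ ((pm + pn) * (pr + ps)) *: tri r s (tri m n t).
Proof.
move=> hm hn hr hs.
have hb := op_star_even ops hm hn; have hc := op_star_even ops hr hs.
have hd := op_partial_even ops hm hn; have hd' := op_partial_even ops hr hs.
rewrite (op_partial_comm hn hm) (op_star_anticomm hn hm).
rewrite !(bilinear_mapE dM, bilinear_mapE bullet, bilinear_mapE star,
          bilinear_mapE partial).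
rewrite (op_dM_partial t hd hr hs).
rewrite (op_dM_bullet t hd hc) (op_dM_bullet t hd' hb).
rewrite (op_dJ_star s hd hr) (op_dJ_partial hb hr hs).
rewrite (op_partial_bullet hb hr hs).
rewrite !(bilinear_mapE dM, bilinear_mapE bullet) (op_dM_angle t hb hc).
by case: pm pn pr ps {hm hn hr hs hb hc hd hd'} => [] [] [] []; linear_arith.
Qed.

Lemma short_isJTernary : isJTernary dot bullet star (fun m n s => tri m n s).
Proof.
split.
- split; [exact: op_dot_even|exact: op_dot_comm|exact: op_dot_jordan].
- split; [exact: op_bullet_even|exact: op_bullet_special].
- exact: op_star_even.
- exact: op_star_anticomm.
- exact: tri_trilinear.
- exact: tri_even.
- exact: op_star_bullet.
- exact: tri_bullet.
- exact: tri_swap13.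
- by move=> pm pn ps m n s hm hn _; exact: tri_swap12.
- exact: tri_star.
- by move=> pm pn pr ps pt m n r s t hm hn hr hs _; exact: tri_tri.
Qed.

End ShortLie.

Local Open Scope complex_scope.

Theorem theorem3p1 (R : realType) (J M D : superspace R[i])
    (g : shortSl2 J M D) (ops : shortOps g) :
  isJTernary (op_dot ops) (op_bullet ops) (op_star ops)
    (fun m n s => - op_dM ops (op_partial ops m n) s
                  + 2%:R^-1 *: op_bullet ops (op_star ops m n) s).
Proof. by apply: short_isJTernary; rewrite pnatr_eq0. Qed.
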